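(* Let $C$ be a binary singly even self-dual $[130,65,22]$ code whose shadow $S$ has minimum weight at least $5$, with weight enumerators of $C$ and $S$ of the form $$\begin{aligned}W_C=&\,1+(388700 + 2 e)y^{22}+(4791150 + 128 d - 2 e)y^{24}+(81082890 + 8192 c - 896 d - 42 e)y^{26}\\&+(1200197180 + 524288 b - 106496 c + 512 d + 42 e)y^{28}\\&+(14196225992 - 33554432 a - 9961472 b + 532480 c + 10752 d + 420 e) y^{30}+ \cdots,\end{aligned}$$ $$\begin{aligned}W_S=&\,a y^5+(- 30 a + b )y^9+(435 a - 28 b - c )y^{13}+(- 4060 a + 378 b + 26 c + d )y^{17}\\&+(27405 a - 3276 b - 325 c - 24 d - e )y^{21}+ \cdots,\end{aligned}$$ where $a,b,c,d,e$ are integers and the dots denote terms of higher degree. Then $e$ is an even integer.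
   Context: All codes are binary: a code of length $n$ is a subspace of $\mathbb{F}_2^n$, and $[n,k,d]$ denotes length $n$, dimension $k$, minimum weight $d$. A code $C$ is self-dual if $C=C^\perp$ with respect to the standard inner product. A self-dual code is singly even if it contains a codeword of weight $\equiv 2 \pmod 4$. For a singly even self-dual code $C$, let $C_0$ be the subcode of codewords of weight $\equiv 0 \pmod 4$; the shadow of $C$ is $S=C_0^\perp\setminus C$. The weight enumerators are $W_C=\sum_i A_i y^i$ and $W_S=\sum_i B_i y^i$, where $A_i$ and $B_i$ are the numbers of vectors of weight $i$ in $C$ and $S$, respectively. Every singly even self-dual $[130,65,22]$ code with shadow of minimum weight at least $5$ has weight enumerators of the displayed form for some integers $a,b,c,d,e$. *)

(* Defs.v *)
From Stdlib Require Import ZArith.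
From mathcomp Require Import all_boot all_order all_algebra.
From mathcomp Require Import ssrZ.

Set Implicit Arguments.
Unset Strict Implicit.
Unset Printing Implicit Defensive.

Import Order.TTheory GRing.Theory Num.Theory.
Local Open Scope ring_scope.

(* Large integer literals are written [int_of_Z 388700] (binary), since a ring
   numeral is a unary [nat]; simplification must not unfold them. *)
#[global] Arguments int_of_Z : simpl never.

Section Codes.

Variable n : nat.
Implicit Types (A : {set 'rV['F_2]_n}) (C : {vspace 'rV['F_2]_n}).

Definition wt (x : 'rV['F_2]_n) : nat := #|[set i | x 0 i != 0]|.

(* Defined on sets rather than subspaces, since C0 below is only given as a set. *)
Definition dual A : {set 'rV['F_2]_n} :=
  [set x | [forall y in A, x *m y^T == 0]].

Definition min_weight A (d : nat) : Prop :=
  (exists x, [/\ x \in A, x != 0 & wt x = d]) /\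
  (forall x, x \in A -> x != 0 -> (d <= wt x)%N).

Definition is_code C (k d : nat) : Prop :=
  \dim C = k /\ min_weight [set x in C] d.

Definition self_dual C : Prop := [set x in C] = dual [set x in C].

Definition singly_even C : Prop :=
  exists2 x, x \in C & wt x = 2 %[mod 4].

Definition C0 C : {set 'rV['F_2]_n} := [set x in C | (4 %| wt x)%N].

Definition shadow C : {set 'rV['F_2]_n} := dual (C0 C) :\: [set x in C].

Definition weight_enumerator A : {poly int} :=
  \poly_(i < n.+1) (#|[set x in A | wt x == i]|)%:Z.

End Codes.

(* Main.v *)
(* For coordinates i, j put eps(v) = [v_i <> 0] - [v_j <> 0].  Poisson summation
   expresses the sum of eps(s) y^(wt s) over the shadow through the code words; as
   these have weight at least 22, it is divisible by (1 - y)^21, with a cofactor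
   whose value at y = 1 counts the words of weight 22.  Shadow weights are of the
   form 4k + 1, so applying the operators y d/dy - (4l + 1) for 6 <= l <= 26 and
   setting y = 1 leaves only k <= 5 and k >= 27.  The complementation
   s |-> s + 1 identifies these two halves, whence
     sum of eps(u) over u in C of weight 22
       = sum of 'C(26 - k, 21) eps(s) over s in S of weight 4k + 1 <= 21.
   Summing over i and reducing mod 2 gives that B_13 + B_21 is even, and it has
   the parity of e. *)

Require Import Defs.
From Stdlib Require Import ZArith.
From mathcomp Require Import all_boot all_order all_algebra.
From mathcomp Require Import ssrZ.
From mathcomp Require Import algC finfield zify ring.

Set Implicit Arguments.
Unset Strict Implicit.
Unset Printing Implicit Defensive.

Import Order.TTheory GRing.Theory Num.Theory.
Local Open Scope ring_scope.

(** * Arithmetic and signs over the field with two elements *)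

Lemma F2_cases (P : 'F_2 -> Prop) : P 0 -> P 1 -> forall x, P x.
Proof.
move=> P0 P1 [[|[|m]] lt_m2] //.
- by rewrite (_ : Ordinal lt_m2 = 0) //; apply/val_inj.
- by rewrite (_ : Ordinal lt_m2 = 1) //; apply/val_inj.
Qed.

Lemma F2_natr k : (k%:R : 'F_2) = (odd k)%:R.
Proof.
by rewrite -[in LHS](odd_double_half k) natrD -muln2 natrM pchar_Zp // mulr0 addr0.
Qed.

Lemma F2_natr_eq0 k : ((k%:R : 'F_2) == 0) = ~~ odd k.
Proof. by rewrite F2_natr; case: odd. Qed.

Lemma F2_nz (x : 'F_2) : ((x != 0) : nat)%:R = x.
Proof. by elim/F2_cases: x. Qed.

Section Sign.
Variable R : pzRingType.

Definition sg (x : 'F_2) : R := (-1) ^+ (x != 0).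

Lemma sgD x y : sg (x + y) = sg x * sg y.
Proof.
elim/F2_cases: x; elim/F2_cases: y; rewrite /sg /= ?expr0 ?expr1 ?mulr1 ?mul1r //.
by rewrite mulrNN mulr1.
Qed.

Lemma sg_sum (I : finType) (F : I -> 'F_2) : sg (\sum_i F i) = \prod_i sg (F i).
Proof. by apply: (big_morph _ sgD); rewrite /sg eqxx. Qed.

Lemma sg_natr k : sg k%:R = (-1) ^+ k.
Proof. by rewrite /sg F2_natr_eq0 negbK signr_odd. Qed.

End Sign.

(** * Weights, the inner product and the Walsh transform of the weight *)

Section Weight.
Variable n : nat.
Implicit Types u v : 'rV['F_2]_n.

Definition dot u v : 'F_2 := \sum_i u 0 i * v 0 i.

Lemma dotDl u1 u2 v : dot (u1 + u2) v = dot u1 v + dot u2 v.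
Proof. by rewrite /dot -big_split; apply: eq_bigr => i _; rewrite mxE mulrDl. Qed.

Lemma dotC u v : dot u v = dot v u.
Proof. by apply: eq_bigr => i _; rewrite mulrC. Qed.

Lemma mem_dual (A : {set 'rV['F_2]_n}) v :
  (v \in dual A) = [forall u in A, dot u v == 0].
Proof.
rewrite inE; apply: eq_forallb => u; congr (_ ==> _).
rewrite -(inj_eq (@trmx_inj _ _ _)) trmx0 trmx_mul trmxK.
apply/eqP/eqP => [/matrixP/(_ 0 0) | u_v].
  by rewrite !mxE => <-; apply: eq_bigr => i _; rewrite mxE.
apply/matrixP => i j; rewrite !mxE -[RHS]u_v.
by apply: eq_bigr => k _; rewrite !ord1 mxE.
Qed.

Lemma wt_sum v : wt v = (\sum_i (v 0%R i != 0%R))%N.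
Proof. by rewrite /wt -sum1dep_card big_mkcond. Qed.

Lemma wt_le v : (wt v <= n)%N.
Proof. by rewrite /wt -[leqRHS]card_ord max_card. Qed.

Lemma natr_wt v : (wt v)%:R = dot v v.
Proof.
rewrite wt_sum natr_sum; apply: eq_bigr => i _.
by rewrite F2_nz; elim/F2_cases: (v 0 i); rewrite ?mulr0 ?mulr1.
Qed.

Lemma wtD u v : exists2 k, (wt u + wt v = wt (u + v)%R + k.*2)%N & k%:R = dot u v.
Proof.
(* The witness counts the coordinates common to both supports. *)
exists (\sum_i ((u 0%R i * v 0%R i)%R != 0%R))%N.
  rewrite !wt_sum -muln2 big_distrl -!big_split /=; apply: eq_bigr => i _.
  by rewrite mxE; elim/F2_cases: (u 0 i); elim/F2_cases: (v 0 i).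
by rewrite natr_sum; apply: eq_bigr => i _; rewrite F2_nz.
Qed.

Lemma wtD1 v : (wt (v + const_mx 1)%R + wt v = n)%N.
Proof.
rewrite !wt_sum -big_split -[RHS]card_ord -sum1_card /=; apply: eq_bigr => i _.
by rewrite !mxE; elim/F2_cases: (v 0 i).
Qed.

Lemma wt_add_delta v i :
  wt (v + delta_mx 0 i) = (if v 0%R i == 0%R then (wt v).+1 else (wt v).-1)%N.
Proof.
rewrite !wt_sum (bigD1 i) //= [in RHS](bigD1 i) //= !mxE !eqxx.
have -> : (\sum_(k < n | k != i) ((v + delta_mx 0 i)%R 0%R k != 0%R) =
   \sum_(k < n | k != i) (v 0%R k != 0%R))%N.
  by apply: eq_bigr => k /negPf ki; rewrite !mxE ki andbF addr0.
by elim/F2_cases: (v 0 i).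
Qed.

Lemma dot_delta i v : dot (delta_mx 0 i) v = v 0 i.
Proof.
rewrite /dot (bigD1 i) //= big1 => [|k /negPf ki]; rewrite !mxE ?ki ?mul0r //.
by rewrite !eqxx mul1r addr0.
Qed.

(** The sum factors over coordinates: one outside the support of [u] gives 1 + y, one inside gives 1
    - y. *)
Lemma walsh_wt (R : comPzRingType) (y : R) u :
  \sum_v sg R (dot u v) * y ^+ wt v = (1 + y) ^+ (n - wt u) * (1 - y) ^+ wt u.
Proof.
rewrite (reindex (fun f : {ffun 'I_n -> 'F_2} => \row_i f i)) /=; last first.
  exists (fun v : 'rV_n => [ffun i => v 0 i]) => [f _ | v _].
    by apply/ffunP => i; rewrite ffunE mxE.
  by apply/rowP => i; rewrite mxE ffunE.
pose F i (b : 'F_2) : R := sg R (u 0 i * b) * y ^+ (b != 0).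
transitivity (\sum_(f : {ffun 'I_n -> 'F_2}) \prod_i F i (f i)).
  apply: eq_bigr => f _; rewrite big_split /= sg_sum; congr (_ * _).
    by apply: eq_bigr => i _; rewrite mxE.
  by rewrite prodrXr wt_sum; congr (_ ^+ _); apply: eq_bigr => i _; rewrite mxE.
rewrite -bigA_distr_bigA /= (bigID [pred i | u 0 i == 0]) /=; congr (_ * _).
  rewrite (eq_bigr (fun=> 1 + y)) => [|i /eqP ui]; last first.
    rewrite !big_ord_recl big_ord0 /F ui !mul0r /sg eqxx /= !expr0 !mul1r.
    by rewrite addr0.
  rewrite prodr_const; congr (_ ^+ _); apply/eqP.
  rewrite -(eqn_add2r (wt u)) subnK ?wt_le // -[eqbRHS]card_ord -(cardC [pred i | u 0 i == 0]).
  by rewrite /wt cardsE.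
rewrite (eq_bigr (fun=> 1 - y)) => [|i].
  by rewrite prodr_const; congr (_ ^+ _); rewrite /wt cardsE.
rewrite /F; elim/F2_cases: (u 0 i) => // _; rewrite !big_ord_recl big_ord0 !mul1r /sg /=.
by rewrite expr0 expr1 mulN1r addr0 expr1.
Qed.

(** On a self-dual code this is a character, trivial exactly on [C0]. *)
Definition chi u : int := (-1) ^+ (wt u)./2.

Definition eps (i j : 'I_n) v : int := (v 0 i != 0)%:Z - (v 0 j != 0)%:Z.

(** The terms in [j] add up to n copies of one number, which vanish mod 2 for even n. *)
Lemma sum_eps_F2 j v : ~~ odd n ->
  (\sum_i eps i j v)%:~R = (wt v)%:R :> 'F_2.
Proof.
move=> n_even; rewrite /eps sumrB sumr_const card_ord -raddf_sum /=.
rewrite -wt_sum rmorphB rmorphMn /= -mulr_natr (F2_natr n) (negbTE n_even) mulr0 subr0.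
by rewrite -pmulrn.
Qed.

End Weight.

(** * Self-dual codes and their shadows *)

Lemma imaginary_unit_prim : 4.-primitive_root ('i : algC).
Proof.
have i2 : ('i : algC) ^+ 2 = -1 by apply: sqrCi.
have i4 : ('i : algC) ^+ 4 = 1 by rewrite (exprM _ 2 2) i2 sqrrN expr1n.
have nz2 : (-1 == 1 :> algC) = false by rewrite eqNr oner_eq0.
have i_1 : ('i == 1 :> algC) = false.
  by apply: contraFF nz2 => /eqP i1; rewrite -i2 i1 expr1n.
apply/andP; split=> //; apply/forallP => -[[|[|[|[|//]]]] //= _]; rewrite unity_rootE.
- by rewrite i_1.
- by rewrite i2 nz2.
- rewrite eqbF_neg; apply: contraFN i_1 => /eqP i3.
  by have := i4; rewrite exprSr i3 mul1r => ->.
by rewrite i4 !eqxx.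
Qed.

Section SelfDual.
Variables (n : nat) (C : {vspace 'rV['F_2]_n}).
Hypotheses (C_self_dual : self_dual C) (C_singly_even : singly_even C).
Implicit Types u v s : 'rV['F_2]_n.

Lemma mem_self_dual v : (v \in C) = [forall u in C, dot u v == 0].
Proof.
have /setP/(_ v) := C_self_dual; rewrite mem_dual inE => ->.
by apply: eq_forallb => u; rewrite inE.
Qed.

Lemma dot_code u v : u \in C -> v \in C -> dot u v = 0.
Proof. by move=> Cu; rewrite mem_self_dual => /forall_inP/(_ u Cu)/eqP. Qed.

Lemma wt_code_even u : u \in C -> ~~ odd (wt u).
Proof. by move=> Cu; rewrite -F2_natr_eq0 natr_wt dot_code. Qed.

(** Orthogonal words overlap in an even number k of places, so the 2k lost in the weight of the sum
    is divisible by 4. *)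
Lemma half_wtD u v : u \in C -> v \in C ->
  ((wt (u + v))./2%:R : 'F_2) = (wt u)./2%:R + (wt v)./2%:R.
Proof.
move=> Cu Cv; have [k wt_uv /eqP] := wtD u v.
rewrite dot_code // F2_natr_eq0 => k_even.
have := wt_code_even Cu; have := wt_code_even Cv.
have := wt_code_even (rpredD Cu Cv) => ouv ov ou.
rewrite -natrD F2_natr [RHS]F2_natr; congr (nat_of_bool _)%:R; lia.
Qed.

Lemma C0P u : (u \in C0 C) = (u \in C) && (((wt u)./2)%:R == 0 :> 'F_2).
Proof.
rewrite inE F2_natr_eq0; case: (boolP (u \in C)) => //= /wt_code_even.
lia.
Qed.

(** Half the weight mod 2 is a nonzero functional on [C] with kernel [C0]. A functional v that
    vanishes on this index-2 kernel but not on all of [C] must coincide with it. *)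
Lemma shadowP v :
  reflect (forall u, u \in C -> dot u v = ((wt u)./2)%:R) (v \in shadow C).
Proof.
rewrite inE mem_dual inE mem_self_dual.
apply: (iffP andP) => [[/forall_inPn[u1 Cu1 u1v] /forall_inP vC0] u Cu | Cv].
  have nz1 : (wt u1)./2%:R != 0 :> 'F_2.
    by apply: contraNN u1v => w1; apply: vC0; rewrite C0P Cu1.
  have := vC0 (u + u1); rewrite !C0P rpredD // half_wtD // dotDl.
  have := vC0 u; rewrite C0P Cu.
  move: u1v nz1.
  elim/F2_cases: (dot u1 v) => //; elim/F2_cases: ((wt u1)./2%:R) => // _ _.
  elim/F2_cases: ((wt u)./2%:R).
    by move=> /(_ isT)/eqP.
  by elim/F2_cases: (dot u v) => // _ /(_ isT).
split; last first.
  apply/forall_inP => u; rewrite C0P => /andP[Cu /eqP wu]; by rewrite Cv ?wu.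
apply/forall_inPn; have [u Cu wu] := C_singly_even; exists u => //.
rewrite Cv // F2_natr_eq0 negbK; lia.
Qed.

Lemma all_one_code : const_mx 1 \in C.
Proof.
rewrite mem_self_dual; apply/forall_inP => u Cu.
rewrite (_ : dot _ _ = (wt u)%:R) ?F2_natr_eq0 ?wt_code_even //.
rewrite natr_wt; apply: eq_bigr => i _; rewrite mxE mulr1.
by elim/F2_cases: (u 0 i); rewrite ?mulr0 ?mulr1.
Qed.

Lemma shadowD1 v : v \in shadow C -> v + const_mx 1 \in shadow C.
Proof.
move=> /shadowP Sv; apply/shadowP => u Cu.
by rewrite dotC dotDl dotC Sv // dot_code ?addr0 ?all_one_code.
Qed.

(** Orthogonality of characters: outside the shadow some [u1] in [C] has sign -1, and translating by
    it negates the sum. *)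
Lemma shadow_char_sum v :
  \sum_(u in C) chi u * sg int (dot u v) = (#|C| * (v \in shadow C))%:R.
Proof.
have chiE u : chi u * sg int (dot u v) = sg int (((wt u)./2)%:R + dot u v).
  by rewrite sgD sg_natr.
have mem_S : (v \in shadow C) = [forall u in C, dot u v == (wt u)./2%:R].
  by apply/shadowP/forall_inP => vS u /vS/eqP.
case: (boolP (v \in shadow C)) => [/shadowP Sv | ].
  rewrite muln1 -sum1_card natr_sum; apply: eq_bigr => u Cu.
  rewrite chiE Sv // /sg.
  by elim/F2_cases: ((wt u)./2%:R).
rewrite mem_S muln0 => /forall_inPn[u1 Cu1 u1v].
set S := \sum_(u in C) _; suff : S = - S by lia.
rewrite {1}/S (reindex_inj (addIr u1)) /= -sumrN.
apply: eq_big => [u | u Cu]; first by rewrite (rpredDr _ Cu1).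
rewrite !chiE half_wtD ?dotDl; last 2 first.
- by move: Cu; rewrite (rpredDr _ Cu1).
- by [].
rewrite addrACA sgD -mulrN1; congr (_ * _); move: u1v.
by elim/F2_cases: (dot u1 v); elim/F2_cases: ((wt u1)./2%:R).
Qed.

Lemma shadow_poisson (R : comPzRingType) (g : 'rV['F_2]_n -> R) :
  #|C|%:R * \sum_(s in shadow C) g s =
  \sum_(u in C) (chi u)%:~R * \sum_v sg R (dot u v) * g v.
Proof.
transitivity (\sum_v (\sum_(u in C) chi u * sg int (dot u v))%:~R * g v).
  rewrite mulr_sumr big_mkcond /=; apply: eq_bigr => v _.
  rewrite shadow_char_sum natz pmulrn -[(_%:~R)]/(_%:R).
  by case: (v \in _); rewrite ?muln1 // muln0 mul0r.
under eq_bigr => v _ do rewrite rmorph_sum /= mulr_suml.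
rewrite exchange_big /=; apply: eq_bigr => u _; rewrite mulr_sumr.
apply: eq_bigr => v _; rewrite rmorphM /= mulrA; congr (_ * _ * _).
by rewrite /sg rmorph_sign.
Qed.

Lemma shadow_enum (R : comPzRingType) (y : R) :
  #|C|%:R * \sum_(s in shadow C) y ^+ wt s =
  \sum_(u in C) (chi u)%:~R * ((1 + y) ^+ (n - wt u) * (1 - y) ^+ wt u).
Proof.
rewrite shadow_poisson; apply: eq_bigr => u _; congr (_ * _); exact: walsh_wt.
Qed.

(** At y = 1 every term of [shadow_enum] vanishes except that of the zero word. *)
Lemma card_shadow : (#|C| * #|shadow C| = 2 ^ n)%N.
Proof.
have := shadow_enum (1 : int).
rewrite [in RHS](bigD1 0) ?mem0v //= [X in _ + X]big1 => [|u /andP[_ u0]].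
  have wt0 : wt (0 : 'rV['F_2]_n) = 0%N.
    by rewrite wt_sum big1 // => i; rewrite mxE eqxx.
  rewrite wt0.
  rewrite addr0 subn0 expr0 mulr1 (_ : chi 0 = 1) ?mul1r; last first.
    by rewrite /chi wt0.
  under eq_bigr do rewrite expr1n.
  rewrite sumr_const -natrM -[1 + 1]/(2%:R) -natrX => /eqP.
  by rewrite eqr_nat => /eqP.
rewrite subrr expr0n; suff -> : (wt u == 0%N) = false by rewrite !mulr0.
apply: contraNF u0; rewrite cards_eq0 => /eqP/setP u0.
apply/eqP/rowP => i; have := u0 i; rewrite !inE mxE.
by case: eqP.
Qed.

(* The sum of i^(wt s) over the shadow is (2i)^m, while the shadow has 2^m
   elements: this is the equality case of the triangle inequality. *)
Lemma shadow_wt_mod4 m s : n = m.*2 -> \dim C = m -> s \in shadow C -> wt s = m %[mod 4].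
Proof.
move=> n2 dimC Ss.
have cardC : #|C| = (2 ^ m)%N by rewrite card_vspace dimC card_Fp.
have cardS : #|shadow C| = (2 ^ m)%N.
  have e2 : (2 ^ n = 2 ^ m * 2 ^ m)%N by rewrite n2 -addnn expnD.
  have := card_shadow; rewrite cardC e2 => /eqP.
  by rewrite eqn_pmul2l ?expn_gt0 // => /eqP.
have nz2 : (2%:R : algC) ^+ m != 0 by rewrite expf_neq0 // pnatr_eq0.
have nzi k : ('i : algC) ^+ k != 0 by rewrite expf_neq0 // neq0Ci.
have sumS : \sum_(v in shadow C) ('i : algC) ^+ wt v / 'i ^+ m = \sum_(v in shadow C) 1.
  rewrite sumr_const cardS -mulr_suml natrX.
  apply: (mulfI nz2); rewrite mulrA -[in LHS]natrX -cardC shadow_enum.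
  apply: (mulIf (nzi m)); rewrite divfK //.
  (* At y = i the term of u is chi(u) (1 + i)^n (-i)^(wt u), and (-i)^(wt u) = chi(u) since wt u is
     even. So all terms equal (1 + i)^n = (2i)^m. *)
  have onei : 1 - 'i = (1 + 'i) * - 'i :> algC.
    by rewrite mulrDl mul1r mulrN -expr2 sqrCi opprK addrC.
  have twoi : (1 + 'i) ^+ 2 = 2%:R * 'i :> algC.
    by rewrite sqrrD expr1n sqrCi mul1r addrAC subrr add0r mulr_natl.
  rewrite (eq_bigr (fun=> (1 + 'i) ^+ n)) => [|u Cu].
    rewrite sumr_const cardC (_ : _ ^+ n = (2%:R * 'i) ^+ m).
      by rewrite -[LHS]mulr_natl natrX exprMn mulrA.
    by rewrite -twoi -exprM mul2n n2.
  rewrite onei exprMn [X in _ * X]mulrA -exprD subnK ?wt_le //.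
  have wu := wt_code_even Cu.
  have -> : (- 'i : algC) ^+ wt u = (-1) ^+ (wt u)./2.
    rewrite -{1}[wt u](odd_double_half) (negbTE wu) add0n -mul2n exprM sqrrN.
    by rewrite sqrCi.
  by rewrite mulrCA /chi rmorph_sign -expr2 sqrr_sign mulr1.
have /eqP : ('i : algC) ^+ wt s / 'i ^+ m = 1.
  apply: (normC_sum_upper _ sumS Ss) => v _.
  by rewrite normf_div !normrX normCi !expr1n divr1.
rewrite -(inj_eq (mulIf (nzi m))) divfK // mul1r.
by rewrite (eq_prim_root_expr imaginary_unit_prim) => /eqP.
Qed.

(** Twice [eps] is a difference of signs, and a sign at coordinate j shifts u by the j-th unit
    vector in the Walsh transform. The two shifted kernels cancel when u_i = u_j; otherwise their
    difference carries (1 - y)^2 - (1 + y)^2 = -4y, up to sign. *)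
Lemma shadow_eps_enum (i j : 'I_n) (R : idomainType) (y : R) : 2%:R != 0 :> R ->
  #|C|%:R * \sum_(s in shadow C) (eps i j s)%:~R * y ^+ wt s =
  - 2%:R * y * \sum_(u in C) (chi u * eps i j u)%:~R *
    ((1 + y) ^+ (n.-1 - wt u) * (1 - y) ^+ (wt u).-1).
Proof.
move=> nz2; apply: (mulfI nz2); pose K u := (1 + y) ^+ (n - wt u) * (1 - y) ^+ wt u.
have eps_sg v : 2%:R * (eps i j v)%:~R = sg R (v 0 j) - sg R (v 0 i).
  rewrite /eps /sg.
  by elim/F2_cases: (v 0 i); elim/F2_cases: (v 0 j); rewrite /= ?expr0 ?expr1; ring.
rewrite mulrCA mulr_sumr; under eq_bigr => v _ do rewrite mulrA eps_sg.
rewrite shadow_poisson mulr_sumr mulr_sumr; apply: eq_bigr => u Cu.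
rewrite rmorphM /=.
transitivity ((chi u)%:~R * (K (u + delta_mx 0 j) - K (u + delta_mx 0 i))).
  congr (_ * _); rewrite /K -!walsh_wt -sumrB; apply: eq_bigr => v _.
  by rewrite !dotDl !dot_delta !sgD; ring.
transitivity ((chi u)%:~R * (- 4%:R * y * (eps i j u)%:~R *
   ((1 + y) ^+ (n.-1 - wt u) * (1 - y) ^+ (wt u).-1))); last by ring.
congr (_ * _); rewrite /K !wt_add_delta /eps.
(* When u_i and u_j differ, 0 < wt u < n, so no predecessor or subtraction truncates. *)
have wtu k l : u 0 k = 0 -> u 0 l = 1 ->
    [/\ (wt u).+1 = (wt u).-1.+2, n - (wt u).+1 = n.-1 - wt u &
        n - (wt u).-1 = (n.-1 - wt u).+2]%N.
  move=> uk ul.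
  have := wt_le (u + delta_mx 0 k); rewrite wt_add_delta uk eqxx.
  have : (0 < wt u)%N by apply/card_gt0P; exists l; rewrite inE ul.
  by split; lia.
have := wtu i j; have := wtu j i.
elim/F2_cases: (u 0 i); elim/F2_cases: (u 0 j); rewrite /=; try by move=> *; ring.
  by move=> _ [// | // | w1 -> ->]; rewrite w1 !exprS; ring.
by move=> [// | // | w1 -> ->] _; rewrite w1 !exprS; ring.
Qed.
End SelfDual.

(** * Euler operators and the product of their eigenvalues *)

Section Euler.
Variable R : comNzRingType.
Implicit Types (p r : {poly R}) (cs : seq R).

Definition euler p c : {poly R} := 'X * p^`() - c *: p.

(** Each operator removes one factor 1 - X. Differentiating (1 - X)^(k+1) multiplies the cofactor at
    1 by -(k+1); the other terms keep all k+1 factors, so the shifts [cs] do not affect the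
    value. *)
Lemma foldl_euler_root cs p r : p = (1 - 'X) ^+ size cs * r ->
  (foldl euler p cs).[1] = (-1) ^+ size cs * (size cs)`!%:R * r.[1].
Proof.
elim: cs p r => [|c cs IHcs] p r /= ->; first by rewrite expr0 !mul1r.
rewrite (IHcs _ (- (size cs).+1%:R *: ('X * r) + (1 - 'X) * ('X * r^`() - c *: r))).
  rewrite !hornerE /= subrr mul0r addr0 factS natrM exprS; ring.
rewrite /euler derivM deriv_exp derivB derivX -[1 : {poly R}]/(1%:P) derivC /=.
rewrite exprS -!mul_polyC polyCN polyC_natr polyC1 -mulr_natr; ring.
Qed.

(** Monomials are eigenvectors: [euler] with shift c scales X^w by w - c. *)
Lemma foldl_euler_sum (I : finType) (P : pred I) (a : I -> R) (w : I -> nat) cs :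
  foldl euler (\sum_(s | P s) a s *: 'X^(w s)) cs =
  \sum_(s | P s) (a s * \prod_(c <- cs) ((w s)%:R - c)) *: 'X^(w s).
Proof.
elim: cs a => [|c cs IHcs] a /=.
  by apply: eq_bigr => s _; rewrite big_nil mulr1.
rewrite (_ : euler _ c = \sum_(s | P s) (a s * ((w s)%:R - c)) *: 'X^(w s)).
  by rewrite IHcs; apply: eq_bigr => s _; rewrite big_cons mulrA.
rewrite /euler raddf_sum /= mulr_sumr scaler_sumr -sumrB; apply: eq_bigr => s _.
rewrite derivZ derivXn -scalerAr mulrnAr.
case: (w s) => [|k]; first by rewrite mulr0n scaler0 !sub0r mulrN mulrC scaleNr scalerA.
rewrite /= -exprS -scaler_nat !scalerA -scalerBl; congr (_ *: _).
by rewrite mulrBr [c * _]mulrC.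
Qed.
End Euler.

(* For shadow vectors of weight 4k + 1, this is the eigenvalue on y^(4k + 1) of
   the product of the operators y d/dy - (4l + 1), 6 <= l <= 26, divided by 4^21;
   the index i stands for l = 26 - i. *)
Definition root_prod (k : int) : int := \prod_(i < 21) (k - 26 + i%:Z).

Lemma root_prod_small k : (k <= 26)%N -> root_prod k%:Z = - ('C(26 - k, 21) * 21`!)%:Z.
Proof.
move=> k26; rewrite bin_ffact ffact_prod /root_prod.
case: (leqP k 5) => [k5 | k5].
  transitivity (\prod_(i < 21) - (26 - k - i)%N%:Z).
    by apply: eq_bigr => i _; have := ltn_ord i; lia.
  by rewrite prodrN card_ord -signr_odd expr1 mulN1r -[in RHS]natz natr_prod; 
    under [in RHS]eq_bigr do rewrite natz.
(* For 6 <= k <= 26 both products contain a zero factor, at index 26 - k. *)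
have lt_i : (26 - k < 21)%N by lia.
rewrite (bigD1 (Ordinal lt_i)) //= (_ : _ + _ = 0) ?mul0r; last by lia.
by rewrite [in RHS](bigD1 (Ordinal lt_i)) //= subnn mul0n.
Qed.

Lemma root_prod_eq0 k : (5 < k <= 26)%N -> root_prod k%:Z = 0.
Proof.
by move=> k_mid; rewrite root_prod_small ?bin_small //; lia.
Qed.

(** Complementation sends weight 4k + 1 to 130 - (4k + 1) = 4(32 - k) + 1. It reverses the roots 6,
    ..., 26 and negates each of the 21 factors. *)
Lemma root_prod_rev k : root_prod (32 - k) = - root_prod k.
Proof.
rewrite /root_prod [LHS](reindex_inj rev_ord_inj) /=.
transitivity (\prod_(i < 21) - (k - 26 + i%:Z)).
  by apply: eq_bigr => i _; have := ltn_ord i; lia.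
by rewrite prodrN card_ord -signr_odd expr1 mulN1r.
Qed.

(** By symmetry these are C(26 - k, 5 - k): 65780, 12650, 2024, 253, 22, 1 for k = 0, ..., 5. *)
Lemma odd_bin21 k : (k < 6)%N -> odd 'C(26 - k, 21) = (k \in [:: 3; 5]).
Proof.
move=> k6; rewrite -bin_sub; last by lia.
by case: k k6 => [|[|[|[|[|[|//]]]]]] _; vm_compute.
Qed.

(** * The moment identity for codes of length 130 *)

Section Length130.
Variable C : {vspace 'rV['F_2]_130}.
Hypotheses (C_self_dual : self_dual C) (C_singly_even : singly_even C).
Hypothesis dimC : \dim C = 65%N.
Hypothesis wtC : forall u, u \in C -> u != 0 -> (22 <= wt u)%N.

Let quarter (s : 'rV['F_2]_130) := (wt s %/ 4)%N.

Lemma shadow_wtE s : s \in shadow C -> wt s = (4 * quarter s).+1.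
Proof.
move=> Ss; have := shadow_wt_mod4 C_self_dual C_singly_even (m := 65%N) (erefl _) dimC Ss.
rewrite /quarter; lia.
Qed.

Lemma shadow_moment (i j : 'I_130) :
  \sum_(s in shadow C) eps i j s * root_prod (quarter s)%:Z =
  - (21`!)%:Z * 2 * \sum_(u in C | wt u == 22%N) eps i j u.
Proof.
pose D : int := \sum_(u in C | wt u == 22%N) eps i j u.
(* 105 - 4k = 4(26 - k) + 1, so [cs] lists 4l + 1 for l from 26 down to 6. *)
pose cs : seq int := [seq (105 - 4 * k%:Z) | k <- index_iota 0 21].
have size_cs : size cs = 21%N by rewrite size_map size_iota.
pose r : {poly int} := - 2%:R * 'X * \sum_(u in C) (chi u * eps i j u)%:~R *
  ((1 + 'X) ^+ (129 - wt u) * (1 - 'X) ^+ ((wt u).-1 - 21)).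
have polyC_int (z : int) : z%:~R = z%:P :> {poly int}.
  by rewrite -{2}[z]intz rmorph_int.
have cardC : #|C| = (2 ^ 65)%N by rewrite card_vspace dimC card_Fp.
(* An opaque [pw] keeps unification from evaluating the powers of 2. *)
have [pw pwE] : {pw : nat -> int | forall k, pw k = 2%:R ^+ k} by exists (fun k => 2%:R ^+ k).
have pwD k l : pw (k + l) = pw k * pw l by rewrite !pwE exprD.
(* At 1 only weight 22 survives, with 1 + X raised to 129 - 22 = 107 and chi = (-1)^11. The zero
   word, where the exponent of 1 - X truncates to 0, is killed by [eps]. *)
have r1 : r.[1] = 2 * pw 107 * D.
  rewrite /r !hornerE horner_sum /= (bigID [pred u | wt u == 22%N]) /=.
  rewrite [X in _ * (_ + X)]big1 => [|u /andP[Cu wu]]; last first.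
    have [u0 | nzu] := eqVneq u 0.
      by rewrite u0 /eps !mxE subrr mulr0 mul0r horner0.
    have nz22 : ((wt u).-1 - 21 == 0)%N = false by move: wu (wtC Cu nzu) => /=; lia.
    by rewrite !hornerE subrr expr0n nz22 /= !mulr0.
  rewrite addr0 (eq_bigr (fun u => - pw 107 * eps i j u)) => [|u /andP[_ /eqP wu]].
    by rewrite -mulr_sumr -/D; ring.
  rewrite polyC_int !hornerE wu subnn expr0 /chi wu /= mulr1.
  by rewrite pwE (_ : (-1) ^+ 11 = -1) // mulrAC mulN1r.
have nz2 : 2%:R != 0 :> {poly int} by rewrite -polyC_natr polyC_eq0.
have := shadow_eps_enum C_self_dual C_singly_even i j 'X nz2.
set L := _ * _; move=> eL.
have /foldl_euler_root : L = (1 - 'X) ^+ size cs * r.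
  rewrite eL size_cs.
  rewrite mulrCA; congr (_ * _); rewrite mulr_sumr; apply: eq_bigr => u Cu.
  rewrite [RHS]mulrCA; have [u0 | nzu] := eqVneq u 0.
    by rewrite u0 /eps !mxE subrr mulr0 !mul0r.
  congr (_ * _); rewrite mulrCA -exprD; congr (_ * _ ^+ _).
  by have := wtC Cu nzu; lia.
have sgn21 : (-1) ^+ 21 = -1 :> int by rewrite -signr_odd expr1.
rewrite size_cs.
move: (21`!)%N => f.
rewrite r1 sgn21 (_ : f%:R = f%:Z) ?natz // mulN1r.
have -> : L = \sum_(s in shadow C) (pw 65 * eps i j s) *: 'X^(wt s).
  rewrite /L mulr_sumr; apply: eq_bigr => s _.
  by rewrite polyC_int cardC mulrA natrX -polyC_natr -polyC_exp -polyCM mul_polyC pwE.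
rewrite foldl_euler_sum horner_sum => moment.
(* Each factor is 4q + 1 - (105 - 4k) = 4(q - 26 + k), with q = [quarter s]; the 21 fours give 2^42,
   which with the 2^65 of [#|C|] makes 2^107. *)
have termE s : s \in shadow C ->
    ((pw 65 * eps i j s * \prod_(c <- cs) ((wt s)%:R - c)) *: 'X^(wt s)).[1] =
    pw 107 * (eps i j s * root_prod (quarter s)%:Z).
  move=> Ss; rewrite hornerZ hornerXn expr1n mulr1 big_map big_mkord.
  rewrite (pwD 65 42) -[RHS]mulrACA; congr (_ * _).
  have -> : pw 42 = \prod_(k < 21) (2%:R ^+ 2).
    by rewrite prodr_const card_ord -exprM pwE.
  rewrite -big_split /=.
  by apply: eq_bigr => k _; rewrite natz (shadow_wtE Ss); lia.
have nz_pw : pw 107 != 0 by rewrite pwE expf_neq0.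
apply: (mulfI nz_pw); rewrite mulr_sumr -(eq_bigr _ termE) moment -/D; ring.
Qed.

Lemma code_shadow_eps (i j : 'I_130) :
  \sum_(u in C | wt u == 22%N) eps i j u =
  \sum_(s in shadow C | (wt s < 22)%N) eps i j s * 'C(26 - quarter s, 21)%:Z.
Proof.
pose F s := eps i j s * root_prod (quarter s)%:Z.
have F0 s : s \in shadow C -> (22 <= wt s < 109)%N -> F s = 0.
  by move=> /shadow_wtE ws hs; rewrite /F root_prod_eq0 ?mulr0 //; lia.
(* Complementation negates both [eps] and [root_prod]. *)
have F1 s : s \in shadow C -> F (s + const_mx 1) = F s.
  move=> Ss; have ws := shadow_wtE Ss.
  have ws1 := shadow_wtE (shadowD1 C_self_dual C_singly_even Ss).
  have quarter1 : (quarter (s + const_mx 1))%:Z = 32 - (quarter s)%:Z.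
    have := wtD1 s; rewrite ws1 ws; move: (quarter _) (quarter _) => a b; lia.
  rewrite /F quarter1.
  rewrite root_prod_rev mulrN -mulNr; congr (_ * _).
  by rewrite /eps !mxE; elim/F2_cases: (s 0 i); elim/F2_cases: (s 0 j).
have halves : \sum_(s in shadow C) F s = 2 * \sum_(s in shadow C | (wt s < 22)%N) F s.
  rewrite (bigID (fun s => wt s < 22)%N) /= mulr_natl mulr2n; congr (_ + _).
  rewrite (reindex_inj (addIr (const_mx 1))) /=.
  have SD1 s : (s + const_mx 1 \in shadow C) = (s \in shadow C).
    apply/idP/idP => /(shadowD1 C_self_dual C_singly_even) //.
    rewrite -addrA (_ : const_mx 1 + const_mx 1 = 0) ?addr0 //.
    by apply/rowP => k; rewrite !mxE; apply/eqP.
  (* The weights of s and its complement sum to 130: they are never both below 22, and if both are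
     at least 22 then [F0] applies. *)
  rewrite big_mkcond [RHS]big_mkcond; apply: eq_bigr => s _; rewrite SD1.
  case: (boolP (s \in shadow C)) => //= Ss; rewrite F1 //.
  move: (wtD1 s) (F0 s Ss); move: (wt (s + _)) (wt s) => a b ab.
  case: (ltnP a 22) => ha; case: (ltnP b 22) => hb //= F0s; first by lia.
  by rewrite F0s //; lia.
have := shadow_moment i j; rewrite halves.
have := root_prod_small; have := fact_gt0 21; move: (21`!)%N => f f_gt0 root_prodE.
have nz : - f%:Z * 2 != 0 by rewrite mulf_neq0 // oppr_eq0 eqz_nat -lt0n.
move=> moment; apply: (mulfI nz); rewrite -moment mulrC [RHS]mulrAC; congr (_ * _).
rewrite mulr_sumr; apply: eq_bigr => s /andP[Ss ws].
rewrite /F root_prodE; last by rewrite /quarter; lia.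
rewrite PoszM; ring.
Qed.
End Length130.

Theorem proposition4 (C : {vspace 'rV['F_2]_130}) (a b c d e : int)
    (hcode : is_code C 65 22) (hself : self_dual C) (hsingly : singly_even C)
    (hshadow : forall x, x \in shadow C -> (5 <= wt x)%N)
    (hWC : take_poly 31 (weight_enumerator [set x in C]) =
        1
        + (int_of_Z 388700 + 2 * e) *: 'X^22
        + (int_of_Z 4791150 + 128 * d - 2 * e) *: 'X^24
        + (int_of_Z 81082890 + int_of_Z 8192 * c - 896 * d - 42 * e) *: 'X^26
        + (int_of_Z 1200197180 + int_of_Z 524288 * b - int_of_Z 106496 * c
           + 512 * d + 42 * e) *: 'X^28
        + (int_of_Z 14196225992 - int_of_Z 33554432 * a - int_of_Z 9961472 * b
           + int_of_Z 532480 * c + int_of_Z 10752 * d + 420 * e) *: 'X^30)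
    (hWS : take_poly 22 (weight_enumerator (shadow C)) =
        a *: 'X^5
        + (- 30 * a + b) *: 'X^9
        + (435 * a - 28 * b - c) *: 'X^13
        + (- int_of_Z 4060 * a + 378 * b + 26 * c + d) *: 'X^17
        + (int_of_Z 27405 * a - int_of_Z 3276 * b - 325 * c - 24 * d - e)
          *: 'X^21) :
  (2 %| e)%Z.

Proof.
have [dimC [_ wtC]] := hcode.
have {wtC} wtC u : u \in C -> u != 0 -> (22 <= wt u)%N.
  by move=> Cu; apply: wtC; rewrite inE.
(* Sum [code_shadow_eps] over i with j fixed. Mod 2 the [eps] become weights: 22 on the code side,
   odd on the shadow side. *)
have parity : \sum_(s in shadow C | (wt s < 22)%N) ('C(26 - wt s %/ 4, 21))%:R = 0 :> 'F_2.
  transitivity (\sum_(u in C | wt u == 22%N) (wt u)%:R : 'F_2); last first.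
    by rewrite big1 // => u /andP[_ /eqP ->]; apply/eqP; rewrite F2_natr_eq0.
  have even_n : ~~ odd 130 by [].
  under [RHS]eq_bigr => u _ do rewrite -(sum_eps_F2 ord0 u even_n).
  rewrite -[RHS]rmorph_sum /= exchange_big /=.
  rewrite (eq_bigr _ (fun i _ => code_shadow_eps hself hsingly dimC wtC i ord0)).
  rewrite exchange_big rmorph_sum /=; apply: eq_bigr => s /andP[Ss _].
  rewrite -mulr_suml rmorphM /= (sum_eps_F2 ord0 s even_n).
  rewrite (_ : (wt s)%:R = 1) ?mul1r // F2_natr.
  have -> // : odd (wt s).
  by have := shadow_wt_mod4 hself hsingly (m := 65%N) (erefl _) dimC Ss; lia.
pose B w := #|[set s in shadow C | wt s == w]|.
(* By [odd_bin21] only k = 3 and k = 5 remain, that is, weights 13 and 21. *)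
have B_even : ~~ odd (B 13 + B 21)%N.
  rewrite -F2_natr_eq0 -[X in _ == X]parity /B -!sum1dep_card !big_mkcondr -big_split natr_sum.
  apply/eqP/eq_bigr => s Ss.
  have := shadow_wtE hself hsingly dimC Ss; move: (wt s) (wt s %/ 4)%N => w k ->.
  have -> : ((4 * k).+1 < 22)%N = (k < 6)%N by lia.
  have -> : ((4 * k).+1 == 13)%N = (k == 3)%N by lia.
  have -> : ((4 * k).+1 == 21)%N = (k == 5)%N by lia.
  case: (ltnP k 6) => k6; last by rewrite !gtn_eqF // (leq_trans _ k6).
  rewrite (F2_natr 'C(_, _)) odd_bin21 // !inE.
  by case: eqP => [-> // | _]; case: eqP.
have coefB w : (w < 22)%N -> (take_poly 22 (weight_enumerator (shadow C)))`_w = (B w)%:Z.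
  by move=> w22; rewrite coef_take_poly w22 coef_poly ifT //; lia.
have B13 : (B 13)%:Z = 435 * a - 28 * b - c.
  rewrite -coefB // hWS !coefE /=; lia.
have B21 : (B 21)%:Z = int_of_Z 27405 * a - int_of_Z 3276 * b - 325 * c - 24 * d - e.
  rewrite -coefB // hWS !coefE /=; lia.
clear -B_even B13 B21.
(* The sum is 27840a - 3304b - 326c - 24d - e, congruent to e mod 2. *)
move: (B 13%N) (B 21%N) B_even B13 B21 => m n; lia.
Qed.
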